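(* Let $\mathfrak{g}$ be a finite-dimensional real or complex Lie algebra and let $k \geq 0$ be an integer. Then the codimension in $\mathfrak{g}^*$ of the set $$\{\mu \in \mathfrak{g}^* \mid \dim\,[\mathfrak{g}_\mu, \mathfrak{g}_\mu] \geq k\}$$ is at least $k$.
   Context: For $\mu \in \mathfrak{g}^*$, $\mathfrak{g}_\mu = \{x \in \mathfrak{g} \mid \mathrm{ad}^*x(\mu) = 0\}$ is the stabilizer of $\mu$ with respect to the coadjoint representation; equivalently, $x \in \mathfrak{g}_\mu$ if and only if $\langle \mu, [x,y]\rangle = 0$ for all $y \in \mathfrak{g}$. Dimensions and codimensions are taken over the ground field ($\mathbb{R}$ or $\mathbb{C}$). *)

(* Defs.v *)
From HB Require Import structures.
From mathcomp Require Import all_boot all_order all_algebra.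
From mathcomp Require Export ring_quotient mpoly.
From mathcomp Require Export reals complex.

Set Implicit Arguments.
Unset Strict Implicit.
Unset Printing Implicit Defensive.

Import GRing.Theory.
Local Open Scope ring_scope.

HB.mixin Record Vector_isLieAlgebra (K : fieldType) (g : Type)
    of Vector K g := {
  lie : g -> g -> g;
  lie_linearl : forall y, linear (lie^~ y);
  lie_linearr : forall x, linear (lie x);
  liexx : forall x, lie x x = 0;
  lie_jacobi : forall x y z,
    lie x (lie y z) + lie y (lie z x) + lie z (lie x y) = 0
}.

#[short(type="lieAlgType")]
HB.structure Definition LieAlgebra (K : fieldType) :=
  {g of Vector K g & Vector_isLieAlgebra K g}.

Section LieAlgebraTheory.
Variables (K : fieldType) (g : lieAlgType K).
Implicit Types (x y : g) (U V W : {vspace g}) (mu : 'Hom(g, K^o)).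

(* The span of all brackets [u, v] with u in U and v in V (see lievP); as for
   prodv, bases of U and V are enough. *)
Definition liev U V : {vspace g} :=
  <<[seq lie u v | u <- vbasis U, v <- vbasis V]>>%VS.

Lemma liev_mem U V x y : x \in U -> y \in V -> lie x y \in liev U V.
Proof.
pose llin z := GRing.isLinear.Build K g g *:%R (lie^~ z) (lie_linearl z).
pose rlin z := GRing.isLinear.Build K g g *:%R (lie z) (lie_linearr z).
pose fl z : {linear g -> g} := HB.pack (lie^~ z) (llin z).
pose fr z : {linear g -> g} := HB.pack (lie z) (rlin z).
move=> /coord_vbasis -> /coord_vbasis ->.
rewrite -[lie _ _]/(fl _ _) linear_sum memv_suml // => i _.
rewrite linearZ memvZ //= -[lie _ _]/(fr _ _) linear_sum memv_suml // => j _.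
rewrite linearZ memvZ //= memv_span //.
by apply/allpairsP; exists ((vbasis U)`_i, (vbasis V)`_j);
   split; rewrite //= mem_nth // size_tuple.
Qed.

Lemma lievP U V W :
  reflect {in U & V, forall u v, lie u v \in W} (liev U V <= W)%VS.
Proof.
apply: (iffP idP) => [/subvP sUVW u v uU vV | UVW].
  exact/sUVW/liev_mem.
by apply/span_subvP => _ /allpairsP[[u v] /= [/vbasis_mem uU /vbasis_mem vV ->]];
   apply: UVW.
Qed.

(* The dual g^* is 'Hom(g, K^o). *)
Definition coad x mu : 'Hom(g, K^o) := linfun (fun y => - mu (lie x y) : K^o).

Lemma coadE x mu y : coad x mu y = - mu (lie x y).
Proof.
have lin : linear (fun y => - mu (lie x y) : K^o).
  by move=> a u v /=; rewrite lie_linearr linearP opprD scalerN.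
pose f : {linear g -> K^o} := HB.pack (fun y => - mu (lie x y) : K^o)
  (GRing.isLinear.Build K g K^o *:%R _ lin).
by rewrite /coad -[LHS]/(linfun f y) lfunE.
Qed.

Definition stab mu : {vspace g} := lker (linfun (coad^~ mu)).

Lemma mem_stab mu x : (x \in stab mu) = (coad x mu == 0).
Proof.
have lin : linear (coad^~ mu).
  move=> a u v; apply/lfunP => y; rewrite add_lfunE scale_lfunE !coadE.
  by rewrite lie_linearl linearP opprD scalerN.
pose f : {linear g -> 'Hom(g, K^o)} := HB.pack (coad^~ mu)
  (GRing.isLinear.Build K g _ *:%R _ lin).
by rewrite memv_ker -[linfun _ x]/(linfun f x) lfunE.
Qed.

Lemma stabP mu x : reflect (forall y, mu (lie x y) = 0) (x \in stab mu).
Proof.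
rewrite mem_stab; apply: (iffP eqP) => [h y | h].
  by apply: oppr_inj; rewrite -coadE h lfunE oppr0.
by apply/lfunP => y; rewrite coadE h lfunE /= oppr0.
Qed.

Definition derived_stab_ge (k : nat) : {pred 'Hom(g, K^o)} :=
  [pred mu | (k <= \dim (liev (stab mu) (stab mu)))%N].

End LieAlgebraTheory.

Arguments derived_stab_ge {K} g k.

(* The dimension of a subset S of V is that of its Zariski closure, i.e. the
   Krull dimension of K[V]/I(S) for I(S) the ideal of the polynomial functions
   vanishing on S. For constructible sets over the complex numbers, and for
   semialgebraic sets over the reals, this is the usual dimension. *)
Section Codimension.
Variables (K : fieldType) (V : vectType K).
Implicit Types (S : {pred V}) (d k : nat).

Definition polyfun (p : {mpoly K[\dim {:V}]}) (v : V) : K :=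
  p.@[fun i => coord (vbasis {:V}) i v].

Definition vanishes_on (p : {mpoly K[\dim {:V}]}) S : Prop :=
  {in S, forall v, polyfun p v = 0}.

(* A chain P 0 < ... < P d of prime ideals of K[V] containing I(S), that is,
   a chain of length d of prime ideals of K[V]/I(S). *)
Definition prime_chain S d
    (P : 'I_d.+1 -> prime_idealr {mpoly K[\dim {:V}]}) : Prop :=
  (forall i p, vanishes_on p S -> p \in P i) /\
  (forall i j : 'I_d.+1, (i < j)%N ->
     {subset P i <= P j} /\ exists2 p, p \in P j & p \notin P i).

(* dim S <= dim V - k, where dim S is the supremum of the lengths of chains.
   The empty set has no chains: its codimension is infinite. *)
Definition codim_ge S k : Prop :=
  forall d (P : 'I_d.+1 -> prime_idealr {mpoly K[\dim {:V}]}),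
    prime_chain S P -> (d + k <= \dim {:V})%N.

End Codimension.

(* Main.v *)
(* Over a field K of characteristic 0, let d be the length of a chain of
   primes P_0 < ... < P_d containing the ideal of S = {mu | dim [g_mu, g_mu]
   >= k}. Picking f_i in P_i \ P_(i-1) gives f_1, ..., f_d in K[g^*] which
   are algebraically independent modulo P_0, so that no nonzero h in K[f_1,
   ..., f_d] vanishes on S. Hence there is an ultrafilter on g^* containing S
   and all the sets {h != 0}; in the ultrapower L of K, the point m given by
   the coordinate functions is a generic point of S. It comes with x_j, y_j
   in its stabilizer such that the brackets w_j = [x_j, y_j], for j < k, are
   linearly independent over L, and f_1(m), ..., f_d(m) are algebraically
   independent over K. As L has characteristic 0, there are derivations D_1,
   ..., D_d over K of subrings of L containing all these elements, such that
   the matrix D_i(f_j(m)) is unitriangular; hence the tangent vectors D_i m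
   are independent. Differentiating <m, [x_j, y_j]> = 0 yields <D_i m, w_j> =
   0, because x_j and y_j stabilize m. So L^n contains d independent vectors
   orthogonal to k independent ones, and d + k <= n. *)
Require Import Defs.
From HB Require Import structures.
From mathcomp Require Import all_boot all_order all_algebra ring.
From mathcomp Require Import boolp classical_sets functions filter.

Set Implicit Arguments.
Unset Strict Implicit.
Unset Printing Implicit Defensive.

Import GRing.Theory.
Local Open Scope ring_scope.

(** * Algebraic independence along a chain of primes *)

Section Adjunction.
Variable A : comNzRingType.
Implicit Types (E : subringClosed A) (f z : A) (fs : seq A) (p : {poly A}).

Definition adjoin (E : {pred A}) f : {pred A} :=
  [pred z | `[< exists2 p, p \is a polyOver E & z = p.[f] >]].

Lemma adjoinP (E : {pred A}) f z :
  reflect (exists2 p, p \is a polyOver E & z = p.[f]) (z \in adjoin E f).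
Proof. exact: asboolP. Qed.

Lemma adjoin_subring E f : subring_closed (adjoin E f).
Proof.
split.
- by apply/adjoinP; exists 1; rewrite ?rpred1 ?hornerC.
- move=> _ _ /adjoinP[p pE ->] /adjoinP[q qE ->]; apply/adjoinP.
  by exists (p - q); rewrite ?rpredB ?hornerE.
- move=> _ _ /adjoinP[p pE ->] /adjoinP[q qE ->]; apply/adjoinP.
  by exists (p * q); rewrite ?rpredM ?hornerE.
Qed.

HB.instance Definition _ E f :=
  GRing.isSubringClosed.Build A (adjoin E f) (adjoin_subring E f).

Lemma adjoin_sub E f : {subset E <= adjoin E f}.
Proof.
by move=> z zE; apply/adjoinP; exists z%:P; rewrite ?polyOverC ?hornerC.
Qed.

Lemma adjoin_gen E f : f \in adjoin E f.
Proof. by apply/adjoinP; exists 'X; rewrite ?polyOverX ?hornerX. Qed.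

(** Lists are adjoined from their end, the head coming last: a chain of primes, descended from the
    top, yields its elements in this order. *)
Fixpoint gens E fs : subringClosed A :=
  if fs is f :: fs' then adjoin (gens E fs') f else E.

Definition transcendental (E : {pred A}) f :=
  forall p, p \is a polyOver E -> p.[f] = 0 -> p = 0.

Fixpoint algindep E fs : Prop :=
  if fs is f :: fs' then transcendental (gens E fs') f /\ algindep E fs'
  else True.

Lemma sub_gens_drop E fs i : {subset gens E (drop i fs) <= gens E fs}.
Proof.
elim: fs i => [|f fs IH] [|i] //= z /IH; exact: adjoin_sub.
Qed.

Lemma mem_gens E fs f : f \in fs -> f \in gens E fs.
Proof.
elim: fs => // f' fs IH; rewrite inE => /predU1P[->|/IH].
  exact: adjoin_gen.
exact: adjoin_sub.
Qed.

Lemma algindep_drop E fs i : algindep E fs -> algindep E (drop i fs).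
Proof. by elim: fs i => [|f fs IH] [|i] //= [_ /IH]. Qed.

(** Induct on [p]. As [p.[f]] and [f] lie in [P'], so does the constant term [c], whence [c = 0];
    then [f] divides [p.[f]], and since [f] is not in the prime [P], the cofactor is in [P]. *)
Lemma horner_prime_eq0 E (P P' : prime_idealr A) f p :
    {subset P <= P'} -> f \in P' -> f \notin P ->
    (forall z, z \in E -> z \in P' -> z = 0) ->
  p \is a polyOver E -> p.[f] \in P -> p = 0.
Proof.
move=> sPP' fP' fP E0; elim/poly_ind: p => // p c IH /polyOverP pE.
rewrite hornerMXaddC => pP.
have cE : c \in E by have := pE 0; rewrite coefD coefMX coefC add0r.
have {}pE : p \is a polyOver E.
  by apply/polyOverP => i; have := pE i.+1; rewrite coefD coefMX coefC addr0.
have c0 : c = 0.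
  apply: E0 => //.
  by rewrite -[c](addKr (p.[f] * f)) rpredD ?rpredN ?(idealMr _ fP') ?sPP'.
move: pP; rewrite c0 !addr0 prime_idealrM (negPf fP) orbF => /(IH pE) ->.
by rewrite mul0r.
Qed.

(** The chain without [P ord0] gives the tail of [fs], whose ring meets the second prime only in 0;
    an element of the second prime outside [P ord0] is then put in front by [horner_prime_eq0]. *)
Lemma chain_algindep E d (P : 'I_d.+1 -> prime_idealr A) :
    (forall (I : prime_idealr A) z, z \in E -> z \in I -> z = 0) ->
    (forall i j : 'I_d.+1, (i < j)%N ->
      {subset P i <= P j} /\ exists2 p, p \in P j & p \notin P i) ->
  exists fs, [/\ size fs = d, algindep E fs &
                 forall z, z \in gens E fs -> z \in P ord0 -> z = 0].
Proof.
move=> E0; elim: d P => [|d IH] P chainP.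
  by exists [::]; split=> // z; apply: E0.
have [|fs [szfs indfs fs0]] := IH (fun i => P (lift ord0 i)).
  by move=> i j lt_ij; apply: chainP; rewrite !lift0.
have [sP [f fP' fP]] := chainP ord0 (lift ord0 ord0) isT.
have H p := horner_prime_eq0 sP fP' fP fs0 (p := p).
exists (f :: fs); split=> /=; first by rewrite szfs.
  by split=> // p pE p0; apply: H; rewrite ?p0 ?idealr0.
by move=> z /adjoinP[p pE ->] /(H p pE) ->; rewrite horner0.
Qed.

End Adjunction.

(** * Extending derivations *)

Section Jets.
Variable L : fieldType.
Hypothesis charL : [pchar L] =i pred0.
Implicit Types (G : subringClosed {poly L}) (x : L) (z w : {poly L}).
Implicit Types p q : {poly {poly L}}.

(* {poly L} stands for the dual numbers over L, only the coefficients 0 and 1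
   being relevant: G is the graph of a derivation z`_0 |-> z`_1. *)
Definition single_valued (G : {pred {poly L}}) : Prop :=
  forall z, z \in G -> z`_0 = 0 -> z`_1 = 0.

Lemma coef1M z w : (z * w)`_1 = z`_0 * w`_1 + z`_1 * w`_0.
Proof. by rewrite coefM !big_ord_recl big_ord0 addr0. Qed.

Lemma coef0_horner p w : p.[w]`_0 = (map_poly (coefp 0) p).[w`_0].
Proof. by rewrite -[w`_0]/(coefp 0 w) horner_map. Qed.

(** The chain rule: the derivation acts on the coefficients of [p] and on the point. *)
Lemma coef1_horner p w :
  p.[w]`_1 = (map_poly (coefp 1) p).[w`_0]
             + ((map_poly (coefp 0) p)^`()).[w`_0] * w`_1.
Proof.
elim/poly_ind: p => [|p c IH].
  by rewrite !rmorph0 !raddf0 !horner0 coef0 mul0r addr0.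
rewrite hornerMXaddC coefD coef1M IH coef0_horner.
have cX i : map_poly (coefp i) (p * 'X + c%:P)
            = map_poly (coefp i) p * 'X + (c`_i)%:P.
  have coefE (q : {poly {poly L}}) k : (map_poly (coefp i) q)`_k = q`_k`_i.
    by rewrite coef_map_id0 // [coefp _ _]coef0.
  apply/polyP => j; rewrite coefE !coefD !coefMX !coefC.
  by case: j => [|j] /=; rewrite ?coefE ?coef0 ?add0r ?addr0.
rewrite !cX !derivE !hornerE mulrDl; ring.
Qed.

Lemma coef_map_coefp i p k : (map_poly (coefp i) p)`_k = p`_k`_i.
Proof. by rewrite coef_map_id0 // [coefp _ _]coef0. Qed.

(** The coefficients have value 0, hence derivative 0, and both terms of the chain rule vanish. *)
Lemma coef1_horner_eq0 G p w :
  single_valued G -> p \is a polyOver G -> map_poly (coefp 0) p = 0 ->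
  p.[w]`_1 = 0.
Proof.
move=> svG /polyOverP pG p0; rewrite coef1_horner p0 derivE horner0 mul0r addr0.
suff -> : map_poly (coefp 1) p = 0 by rewrite horner0.
apply/polyP => k; rewrite coef_map_coefp coef0 svG //.
by rewrite -coef_map_coefp p0 coef0.
Qed.

(* If x is transcendental over the values of G, then any lift of x will do;
   otherwise the lift is forced by a polynomial of least degree killing x,
   which is separable since L has characteristic 0. *)
Lemma single_valued_adjoin G x :
  single_valued G ->
  exists2 w : {poly L}, w`_0 = x & single_valued (adjoin G w).
Proof.
move=> svG; pose p0 p := map_poly (coefp 0) p.
pose kills (p : {poly {poly L}}) :=
  [/\ p \is a polyOver G, p0 p != 0 & (p0 p).[x] = 0].
have [[p killp] | nokill] := pselect (exists p, kills p); last first.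
  exists x%:P; first by rewrite coefC.
  move=> _ /adjoinP[p pG ->]; rewrite coef0_horner coefC /= => px.
  apply: (coef1_horner_eq0 _ svG pG); apply/eqP/negPn/negP => pn0.
  by apply: nokill; exists p.
have exn : exists n, `[< exists2 p, kills p & size p = n >].
  by exists (size p); apply/asboolP; exists p.
case: (ex_minnP exn) => n /asboolP[q [qG qn0 qx] szq] minq {p killp}.
have small p : p \is a polyOver G -> (size p < size q)%N -> (p0 p).[x] = 0 ->
    p0 p = 0.
  move=> pG ltpq px; apply/eqP; apply: contraTT ltpq => pn0.
  by rewrite -leqNgt szq minq //; apply/asboolP; exists p.
(* Otherwise the leading coefficient of [q] has value 0, and dropping that term gives a shorter
   polynomial that still kills [x]. *)
have szq0 : size (p0 q) = size q.
  apply/eqP; rewrite eqn_leq size_poly /= leqNgt; apply/negP => lt_q0q.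
  have q_gt0 : (0 < size q)%N by apply: leq_ltn_trans lt_q0q.
  pose r := take_poly (size q).-1 q.
  have r0 : p0 r = p0 q.
    apply/polyP => i; rewrite !coef_map_coefp coef_take_poly.
    case: ltnP => // le_qi; rewrite coef0 -coef_map_coefp nth_default //.
    by apply: leq_trans le_qi; rewrite -ltnS prednK.
  have rG : r \is a polyOver G.
    apply/polyOverP => i; rewrite coef_take_poly.
    by case: ifP => _; rewrite ?rpred0 // (polyOverP qG).
  case/eqP: qn0; rewrite -r0; apply: small; rewrite ?r0 //.
  by rewrite -[ltnRHS](prednK q_gt0) ltnS size_take_poly.
have lead0 : (lead_coef q)`_0 != 0.
  by rewrite lead_coefE -coef_map_coefp -szq0 -lead_coefE lead_coef_eq0.
have gt1q : (1 < size q)%N.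
  rewrite -szq0; apply: (root_size_gt1 (a := x) qn0); exact/rootP.
(* The derivative is shorter, so it would be 0 if [x] were a root; but its top coefficient is a
   nonzero multiple of the leading one, by characteristic 0. *)
have dqn0 : ((p0 q)^`()).[x] != 0.
  have dq0 : p0 q^`() = (p0 q)^`().
    apply/polyP => i.
    by rewrite coef_map_coefp !coef_deriv coefMn coef_map_coefp.
  apply/eqP => dqx; have /polyP/(_ (size q).-2) : (p0 q)^`() = 0.
    rewrite -dq0; apply: small; rewrite ?dq0 ?polyOver_deriv //.
    by rewrite lt_size_deriv // -size_poly_gt0 ltnW.
  rewrite coef0 coef_deriv -subn2 subnSK // subn1 -mulr_natr => /eqP.
  rewrite mulf_eq0 ((pcharf0P L).1 charL) -{1}szq0 -lead_coefE.
  rewrite lead_coef_eq0 (negPf qn0) /=.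
  by rewrite -subn1 subn_eq0 leqNgt gt1q.
(* Solved from the chain rule so that [q.[w]] gets derivative 0. *)
pose u := - (map_poly (coefp 1) q).[x] / ((p0 q)^`()).[x].
exists (x%:P + u *: 'X); first by rewrite coefD coefC coefZ coefX mulr0 addr0.
set w := x%:P + _.
have w0 : w`_0 = x by rewrite coefD coefC coefZ coefX mulr0 addr0.
have w1 : w`_1 = u by rewrite coefD coefC coefZ coefX mulr1 add0r.
have qw0 : q.[w]`_0 = 0 by rewrite coef0_horner w0.
have qw1 : q.[w]`_1 = 0.
  by rewrite coef1_horner w0 w1 mulrCA divff // mulr1 subrr.
move=> _ /adjoinP[p pG ->].
have [m] := ubnP (size p); elim: m => // m IH in p pG * => /ltnSE-le_pm pw0.
have [lt_pq|le_qp] := ltnP (size p) (size q).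
  apply: (coef1_horner_eq0 _ svG pG); apply: small => //.
  by rewrite -w0 -coef0_horner.
(* Pseudo-division by [q], as [G] is only a ring; [lead0] lets the factor [lead_coef q] be cancelled
   at the end. *)
pose r := lead_coef q *: p - lead_coef p *: (q * 'X^(size p - size q)).
have leadE (s : {poly {poly L}}) : s \is a polyOver G -> lead_coef s \in G.
  by move/polyOverP; apply.
have rG : r \is a polyOver G.
  by rewrite rpredB ?polyOverZ ?rpredM ?rpredX ?polyOverX ?leadE.
have le_rm : (size r < m)%N.
  have lt0p : (0 < size p)%N by apply: leq_trans (ltnW gt1q) le_qp.
  apply: leq_trans le_pm; rewrite -[ltnRHS](prednK lt0p) ltnS.
  apply/leq_sizeP => j le_pj; rewrite coefB !coefZ coefMXn.
  rewrite ltnNge (leq_trans _ le_pj) ?leq_sub2l //=; last first.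
    by rewrite -subn1 leq_sub2l // ltnW.
  move: le_pj; rewrite leq_eqVlt => /predU1P[<-|lt_pj].
    have -> : ((size p).-1 - (size p - size q) = (size q).-1)%N.
      by rewrite -!subn1 subnAC subKn.
    by rewrite -!lead_coefE mulrC subrr.
  rewrite prednK // in lt_pj; rewrite !nth_default ?mulr0 ?subrr //.
  by rewrite leq_subRL ?subnK // (leq_trans (leq_subr _ _)).
have rw : r.[w] = lead_coef q * p.[w]
                  - lead_coef p * (q.[w] * w ^+ (size p - size q)).
  by rewrite !hornerE.
have rw0 : r.[w]`_0 = 0.
  by rewrite rw coefB !coef0M pw0 qw0 mul0r !mulr0 subrr.
have := IH r rG le_rm rw0; rewrite rw coefB !coef1M !coef0M pw0 qw0 qw1.
rewrite !(mul0r, mulr0, addr0, subr0) => /eqP.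
by rewrite mulf_eq0 (negPf lead0) /= => /eqP.
Qed.

Lemma single_valued_extend G (xs : seq L) :
  single_valued G -> exists G' : subringClosed {poly L},
    [/\ single_valued G', {subset G <= G'} &
        forall x, x \in xs -> exists2 w, w \in G' & w`_0 = x].
Proof.
move=> svG; elim: xs => [|x xs [G' [svG' sGG' liftG']]].
  by exists G; split.
have [w wx svw] := single_valued_adjoin x svG'.
exists (gens G' [:: w]); split=> //= [z /sGG'|y]; first exact: adjoin_sub.
rewrite inE => /predU1P[->|/liftG'[v vG' vy]].
  by exists w => //; apply: adjoin_gen.
by exists v => //; apply: adjoin_sub.
Qed.

End Jets.

Section SubringImage.
Variables (A B : comNzRingType) (phi : {rmorphism A -> B}).
Implicit Type E : subringClosed A.

Definition subring_image (E : {pred A}) : {pred B} :=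
  [pred z | `[< exists2 a, a \in E & z = phi a >]].

Lemma subring_imageP (E : {pred A}) z :
  reflect (exists2 a, a \in E & z = phi a) (z \in subring_image E).
Proof. exact: asboolP. Qed.

Lemma subring_image_closed E : subring_closed (subring_image E).
Proof.
split.
- by apply/subring_imageP; exists 1; rewrite ?rpred1 ?rmorph1.
- move=> _ _ /subring_imageP[a aE ->] /subring_imageP[b bE ->].
  by apply/subring_imageP; exists (a - b); rewrite ?rpredB ?rmorphB.
- move=> _ _ /subring_imageP[a aE ->] /subring_imageP[b bE ->].
  by apply/subring_imageP; exists (a * b); rewrite ?rpredM ?rmorphM.
Qed.

HB.instance Definition _ E :=
  GRing.isSubringClosed.Build B (subring_image E) (subring_image_closed E).

Lemma polyOver_subring_image E (p : {poly B}) :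
  p \is a polyOver (subring_image E) ->
  exists2 q, q \is a polyOver E & p = map_poly phi q.
Proof.
elim/poly_ind: p => [|p c IH] /polyOverP pE.
  by exists 0; rewrite ?rpred0 ?rmorph0.
have /subring_imageP[a aE ca] : c \in subring_image E.
  by have := pE 0; rewrite coefD coefMX coefC add0r.
have [|q qE ->] := IH.
  by apply/polyOverP => i; have := pE i.+1; rewrite coefD coefMX coefC addr0.
exists (q * 'X + a%:P); first by rewrite rpredD ?rpredM ?polyOverX ?polyOverC.
by rewrite rmorphD rmorphM /= map_polyX map_polyC ca.
Qed.

End SubringImage.

(** * Evaluation of polynomials at jets *)

Section MPolyLifts.
Variables (n : nat) (K : fieldType).

Lemma mpoly_ring_ind (P : {mpoly K[n]} -> Prop) :
    (forall c, P c%:MP) -> (forall i, P 'X_i) ->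
    (forall f g, P f -> P g -> P (f + g)) ->
    (forall f g, P f -> P g -> P (f * g)) ->
  forall f, P f.
Proof.
move=> PC PX PD PM; elim/mpolyind => [|c m f _ _ Pf]; first by rewrite -mpolyC0.
apply: PD => //; rewrite -mul_mpolyC mpolyXE_id; apply: (PM) => //.
apply: (big_ind P) => [||i _] //; first by rewrite -mpolyC1.
elim: (m i) => [|e IH]; first by rewrite expr0 -mpolyC1.
by rewrite exprS; apply: PM.
Qed.

Variables (L : fieldType) (iota : {rmorphism K -> L}) (m : 'I_n -> L).
Implicit Types (f : {mpoly K[n]}) (w : 'I_n -> {poly L}).

Definition ev : {mpoly K[n]} -> L := mmap iota m.
HB.instance Definition _ := GRing.RMorphism.on ev.

(** Scalars of [K] become constant jets: the derivations are over [K]. *)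
Definition lift_ev w : {mpoly K[n]} -> {poly L} := mmap (polyC \o iota) w.
HB.instance Definition _ w := GRing.RMorphism.on (lift_ev w).

Lemma lift_ev0 w f : (forall l, (w l)`_0 = m l) -> (lift_ev w f)`_0 = ev f.
Proof.
move=> wm; elim/mpoly_ring_ind: f => [c|i|f g IHf IHg|f g IHf IHg].
- by rewrite /lift_ev /ev !mmapC coefC.
- by rewrite /lift_ev /ev !mmapX !mmap1U.
- by rewrite !rmorphD coefD IHf IHg.
- by rewrite !rmorphM coef0M IHf IHg.
Qed.

Lemma lift_ev_mem (G : subringClosed {poly L}) w f :
  (forall c, (iota c)%:P \in G) -> (forall l, w l \in G) -> lift_ev w f \in G.
Proof.
move=> cG wG; elim/mpoly_ring_ind: f => [c|i|f g IHf IHg|f g IHf IHg].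
- by rewrite /lift_ev mmapC; apply: cG.
- by rewrite /lift_ev mmapX mmap1U.
- by rewrite rmorphD rpredD.
- by rewrite rmorphM rpredM.
Qed.

(** The witness [c] is the gradient of [f] at [m]; it is chosen before [w], so it serves all tangent
    vectors at once. *)
Lemma gradient f : exists c : 'I_n -> L, forall w,
  (forall l, (w l)`_0 = m l) -> (lift_ev w f)`_1 = \sum_l (w l)`_1 * c l.
Proof.
elim/mpoly_ring_ind: f => [c|i|f g [c fc] [d gd]|f g [c fc] [d gd]].
- exists (fun=> 0) => w _; rewrite /lift_ev mmapC coefC big1 // => l _.
  by rewrite mulr0.
- exists (fun l => (l == i)%:R) => w _; rewrite /lift_ev mmapX mmap1U.
  rewrite (bigD1 i) //= eqxx mulr1 big1 ?addr0 // => l /negPf ->.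
  by rewrite mulr0.
- exists (fun l => c l + d l) => w wm; rewrite rmorphD coefD fc // gd //.
  by rewrite -big_split; apply: eq_bigr => l _; rewrite mulrDr.
- exists (fun l => ev f * d l + c l * ev g) => w wm.
  rewrite rmorphM coef1M !lift_ev0 // fc // gd // mulr_sumr mulr_suml.
  rewrite -big_split; apply: eq_bigr => l _ /=.
  by rewrite [RHS]mulrDr; congr (_ + _); [apply: mulrCA|rewrite mulrA].
Qed.

End MPolyLifts.

(** * Derivations attached to an independent family *)

Section Tangent.
Variable L : fieldType.
Hypothesis charL : [pchar L] =i pred0.

(** This is differentiation with respect to [f], with [E] constant. A value 0 forces [p.[f] = 0] by
    injectivity, then [p = 0] by transcendence. *)
Lemma single_valued_translate (A : comNzRingType) (phi : {rmorphism A -> L})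
    (E : subringClosed A) f :
    transcendental E f -> (forall z, z \in adjoin E f -> phi z = 0 -> z = 0) ->
  single_valued (adjoin (subring_image (polyC \o phi) E) ((phi f)%:P + 'X)).
Proof.
move=> trf inj _ /adjoinP[_ /polyOver_subring_image[p pE ->] ->].
set w := _ + 'X; have w0 : w`_0 = phi f by rewrite coefD coefC coefX addr0.
have p0 : map_poly (coefp 0) (map_poly (polyC \o phi) p) = map_poly phi p.
  by apply/polyP => i; rewrite coef_map_coefp !coef_map /= coefC.
rewrite coef0_horner w0 p0 horner_map => px.
suff -> : p = 0 by rewrite rmorph0 horner0 coef0.
by apply: (trf _ pE); apply: inj px; apply/adjoinP; exists p.
Qed.

(** Differentiate along entry [i] on the ring generated by [E] and the entries from [i] on, then
    extend to [xs]. The derivatives of earlier entries are not controlled, hence a matrix that is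
    only triangular later on. *)
Lemma jet_family (A : comNzRingType) (phi : {rmorphism A -> L})
    (E : subringClosed A) (fs : seq A) (xs : seq L) i :
    algindep E fs -> (forall z, z \in gens E fs -> phi z = 0 -> z = 0) ->
    (i < size fs)%N ->
  exists G : subringClosed {poly L},
    [/\ single_valued G,
        forall x, x \in xs -> exists2 w, w \in G & w`_0 = x,
        forall z, z \in E -> (phi z)%:P \in G,
        forall j, (i < j < size fs)%N -> (phi fs`_j)%:P \in G &
        (phi fs`_i)%:P + 'X \in G].
Proof.
move=> indfs inj lti.
have dropi : drop i fs = fs`_i :: drop i.+1 fs by rewrite (drop_nth 0).
have := algindep_drop i indfs; rewrite dropi => -[trf _].
pose G0 : subringClosed {poly L} :=
  gens (subring_image (polyC \o phi) (gens E (drop i.+1 fs)))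
    [:: (phi fs`_i)%:P + 'X].
have sv0 : single_valued G0.
  apply: single_valued_translate => // z zE; apply: inj.
  by apply: (@sub_gens_drop _ _ _ i); rewrite dropi.
have EG0 z : z \in gens E (drop i.+1 fs) -> (phi z)%:P \in G0.
  by move=> zE; apply/adjoin_sub/subring_imageP; exists z.
have [G [svG sG0G liftG]] := single_valued_extend charL xs sv0.
exists G; split=> //.
- move=> z zE; apply/sG0G/EG0; apply: (@sub_gens_drop _ _ _ (size fs - i.+1)).
  by rewrite drop_oversize // size_drop.
- move=> j /andP[ltij ltj]; apply/sG0G/EG0/mem_gens.
  have -> : fs`_j = (drop i.+1 fs)`_(j - i.+1) by rewrite nth_drop subnKC.
  by rewrite mem_nth // size_drop ltn_sub2r // (leq_ltn_trans ltij).
- exact/sG0G/adjoin_gen.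
Qed.

End Tangent.

(** * Tangent vectors at a generic point *)

Lemma map_coefp1_mulmx (L : fieldType) a b c (M : 'M[{poly L}]_(a, b))
    (N : 'M[{poly L}]_(b, c)) :
  map_mx (coefp 1) (M *m N)
  = map_mx (coefp 0) M *m map_mx (coefp 1) N
    + map_mx (coefp 1) M *m map_mx (coefp 0) N.
Proof.
apply/matrixP => i j; rewrite !mxE /= coef_sum -big_split.
by apply: eq_bigr => l _; rewrite !mxE coef1M.
Qed.

Section GenericPoint.
Variables (n : nat) (K L : fieldType) (iota : {rmorphism K -> L}).
Hypothesis charL : [pchar L] =i pred0.
Variables (m : 'I_n -> L) (E : subringClosed {mpoly K[n]}).
Hypothesis constE : forall c, c%:MP \in E.
Variable fs : seq {mpoly K[n]}.
Hypothesis indfs : algindep E fs.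
Hypothesis ev_inj : forall f, f \in gens E fs -> ev iota m f = 0 -> f = 0.

Variables (k r : nat) (gam : 'I_n -> 'M[K]_r) (X Y : 'M[L]_(k, r)).

(** In the application [gam l] is the matrix of (x, y) |-> e_l([x, y]), and the rows of [X] and [Y]
    are the coordinates of x_j and y_j. Thus [generic_form] is the matrix of <m, [x, y]>, and column
    [j] of [bracket_mx] represents w_j. *)
Definition generic_form : 'M[L]_r := \sum_l m l *: map_mx iota (gam l).
Definition bracket_mx : 'M[L]_(n, k) :=
  \matrix_(l, j) (X *m map_mx iota (gam l) *m Y^T) j j.

Hypothesis (formX : X *m generic_form = 0) (formY : generic_form *m Y^T = 0).

(* As X and Y lie in the radical of generic_form, differentiating the identity
   X *m generic_form *m Y^T = 0 only leaves the derivative of generic_form. *)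
Lemma tangent_orthogonal (i : 'I_(size fs)) : exists w : 'I_n -> {poly L},
  [/\ forall l, (w l)`_0 = m l,
      forall j : 'I_k, \sum_l (w l)`_1 * bracket_mx l j = 0 &
      forall j : 'I_(size fs), (i <= j)%N ->
        (lift_ev iota w fs`_j)`_1 = (i == j)%:R].
Proof.
pose entries (Z : 'M[L]_(k, r)) := codom (fun u : 'I_k * 'I_r => Z u.1 u.2).
have entriesP (Z : 'M_(k, r)) j p : Z j p \in entries Z.
  by apply: (codom_f _ (j, p)).
have [G [svG liftG EG gtG iG]] :=
  jet_family charL (codom m ++ entries X ++ entries Y) indfs ev_inj (ltn_ord i).
have /choice[lift liftP] x : exists w : {poly L},
    x \in codom m ++ entries X ++ entries Y -> w \in G /\ w`_0 = x.
  have [/liftG[w wG w0]|_] := boolP (x \in _); last by exists 0.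
  by exists w.
have mP l : lift (m l) \in G /\ (lift (m l))`_0 = m l.
  by apply: liftP; rewrite !mem_cat codom_f.
have XP j p : lift (X j p) \in G /\ (lift (X j p))`_0 = X j p.
  by apply: liftP; rewrite !mem_cat entriesP orbT.
have YP j p : lift (Y j p) \in G /\ (lift (Y j p))`_0 = Y j p.
  by apply: liftP; rewrite !mem_cat entriesP !orbT.
have cG c : (iota c)%:P \in G.
  by have -> : iota c = ev iota m c%:MP; [rewrite /ev mmapC|apply: EG].
exists (fun l => lift (m l)); split=> [l|j|j le_ij].
- exact: (mP l).2.
- pose X' := map_mx lift X; pose Y' := map_mx lift Y.
  pose B' := \sum_l lift (m l) *: map_mx (polyC \o iota) (gam l).
  have X'0 : map_mx (coefp 0) X' = X.
    by apply/matrixP => a b; rewrite !mxE /= (XP a b).2.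
  have Y'0 : map_mx (coefp 0) Y'^T = Y^T.
    by apply/matrixP => a b; rewrite !mxE /= (YP b a).2.
  have B'E c : map_mx (coefp c) B'
               = \sum_l (lift (m l))`_c *: map_mx iota (gam l).
    apply/matrixP => a b; rewrite mxE !summxE /= coef_sum.
    by apply: eq_bigr => l _; rewrite !mxE /= coefMC.
  have B'0 : map_mx (coefp 0) B' = generic_form.
    by rewrite B'E; apply: eq_bigr => l _; rewrite (mP l).2.
  have X'G a b : X' a b \in G by rewrite mxE (XP a b).1.
  have Y'G a b : Y'^T a b \in G by rewrite !mxE (YP b a).1.
  have B'G a b : B' a b \in G.
    by rewrite summxE rpred_sum // => l _; rewrite !mxE rpredM ?(mP l).1 /= ?cG.
  have mulG u v s (M : 'M[{poly L}]_(u, v)) (N : 'M_(v, s)) :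
      (forall a b, M a b \in G) -> (forall a b, N a b \in G) ->
      forall a b, (M *m N) a b \in G.
    by move=> MG NG a b; rewrite mxE rpred_sum // => l _; apply: rpredM.
  have zG := mulG _ _ _ _ _ (mulG _ _ _ _ _ X'G B'G) Y'G j j.
  have zc c : ((X' *m B' *m Y'^T) j j)`_c
              = map_mx (coefp c) (X' *m B' *m Y'^T) j j by rewrite [RHS]mxE.
  have z0 : ((X' *m B' *m Y'^T) j j)`_0 = 0.
    by rewrite zc !map_mxM X'0 B'0 Y'0 formX mul0mx mxE.
  have := svG _ zG z0.
  rewrite zc !map_coefp1_mulmx map_mxM X'0 B'0 Y'0 formX mul0mx add0r.
  rewrite mulmxDl -[_ *m generic_form *m _]mulmxA formY mulmx0 addr0 B'E.
  rewrite mulmx_sumr mulmx_suml summxE.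
  move=> z1; rewrite -[RHS]z1; apply: eq_bigr => l _.
  by rewrite -scalemxAr -scalemxAl !mxE.
- set w := fun l => _; have wm l : (w l)`_0 = m l by exact: (mP l).2.
  have fG : lift_ev iota w fs`_j \in G.
    by apply: lift_ev_mem => // l; apply: (mP l).1.
  (* Compare with the jet of the same value given by [jet_family], of derivative 1 if [j = i] and 0
     if [j > i]: the difference is in [G] and has value 0. *)
  move: le_ij; rewrite leq_eqVlt => /predU1P[/val_inj eq_ij|lt_ij].
    subst j; rewrite eqxx; apply/eqP; rewrite -subr_eq0; apply/eqP.
    have := svG _ (rpredB fG iG).
    rewrite !coefB !coefD !coefC !coefX (lift_ev0 _ _ wm) addr0 add0r; apply.
    by rewrite subrr.
  have jG : (ev iota m fs`_j)%:P \in G by apply: gtG; rewrite lt_ij ltn_ord.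
  have := svG _ (rpredB fG jG); rewrite !coefB !coefC (lift_ev0 _ _ wm) subr0.
  have /negPf -> : i != j by rewrite neq_ltn lt_ij.
  by apply; rewrite subrr.
Qed.

(** The rows of [V] are the tangent vectors, the columns of [J] the gradients. Their product is
    lower unitriangular, so [V] has rank [size fs]; [bracket_mx] has rank [k], and
    [V *m bracket_mx = 0]. *)
Lemma generic_codim_ge (N : 'M[L]_(k, n)) :
  N *m bracket_mx = 1%:M -> (size fs + k <= n)%N.
Proof.
move=> NW; have [w wP] := choice tangent_orthogonal.
have [c cP] := choice (fun j : 'I_(size fs) => gradient iota m fs`_j).
pose V := \matrix_(i < size fs, l < n) (w i l)`_1.
pose J := \matrix_(l < n, j < size fs) c j l.
have VJ (i j : 'I_(size fs)) : (i <= j)%N -> (V *m J) i j = (i == j)%:R.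
  have [w0 _ wf] := wP i; move=> /wf <-; rewrite (cP j _ w0) mxE.
  by apply: eq_bigr => l _; rewrite !mxE.
have rkV : \rank V = size fs.
  apply/eqP; rewrite eqn_leq rank_leq_row.
  apply: leq_trans (mxrankM_maxl V J); rewrite mxrank_unit // unitmxE det_trig.
    by rewrite big1 ?unitr1 // => i _; rewrite VJ // eqxx.
  apply/is_trig_mxP => i j lt_ij; rewrite VJ 1?ltnW //.
  by have /negPf -> : i != j by rewrite neq_ltn lt_ij.
have rkW : \rank bracket_mx = k.
  apply/eqP; rewrite eqn_leq rank_leq_col -{1}(mxrank1 L k) -NW.
  exact: mxrankM_maxr.
rewrite -{1}rkV -rkW; apply: mulmx0_rank_max.
apply/matrixP => i j; rewrite !mxE; have [_ orth _] := wP i.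
by rewrite -[RHS](orth j); apply: eq_bigr => l _; rewrite [V i l]mxE.
Qed.

End GenericPoint.

(** * Ultrapowers of a field *)

Section Ultrapower.
Local Open Scope classical_set_scope.
Local Open Scope quotient_scope.
Variables (T : pointedType) (K : fieldType) (U : set_system T).
Hypothesis UU : UltraFilter U.

(** The ultrafilter proof is an argument, so that the instances on the quotient can be inferred from
    its type. *)
Definition ultra_ideal of UltraFilter U : {pred T -> K} :=
  fun a => `[< U [set v | a v = 0] >].

Lemma ultra_idealP a : reflect (U [set v | a v = 0]) (a \in ultra_ideal UU).
Proof. exact: asboolP. Qed.

Lemma ultra_ideal_closed : idealr_closed (ultra_ideal UU).
Proof.
split.
- by apply/ultra_idealP; apply: filterS filterT.
- apply/negP => /ultra_idealP /filter_ex[v /= /eqP].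
  by rewrite (oner_eq0 K).
- move=> a b c /ultra_idealP b0 /ultra_idealP c0; apply/ultra_idealP.
  apply: filterS2 b0 c0 => v /= bv cv.
  by rewrite -[LHS]/(a v * b v + c v) bv cv mulr0 addr0.
Qed.

HB.instance Definition _ :=
  isIdealr.Build (T -> K) (ultra_ideal UU) ultra_ideal_closed.

Definition ultrapower := {ideal_quot (ultra_ideal UU)}.
HB.instance Definition _ := GRing.ComNzRing.on ultrapower.

Definition ultra_class : (T -> K) -> ultrapower := \pi_ultrapower.
HB.instance Definition _ := GRing.RMorphism.on ultra_class.

Lemma ultra_class_eq0 a : ultra_class a = 0 <-> U [set v | a v = 0].
Proof.
rewrite -(rmorph0 ultra_class); split.
  by move=> /eqP; rewrite -Quotient.idealrBE subr0 => /ultra_idealP.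
by move=> a0; apply/eqP; rewrite -Quotient.idealrBE subr0; apply/ultra_idealP.
Qed.

Definition ultra_inv (x : ultrapower) : ultrapower :=
  ultra_class (fun v => (repr x v)^-1).

Lemma ultra_class_repr x : ultra_class (repr x) = x.
Proof. exact: reprK. Qed.

(** Either the zero set of a representative or its complement is in [U]; the former would make [x]
    zero, and on the latter pointwise inverses work. *)
Lemma ultra_mulVf x : x != 0 -> ultra_inv x * x = 1.
Proof.
move=> xn0; rewrite -{2}[x]ultra_class_repr -rmorphM -(rmorph1 ultra_class).
apply/eqP; rewrite -subr_eq0 -rmorphB; apply/eqP/ultra_class_eq0.
have [x0|] := in_ultra_setVsetC [set v | repr x v = 0] UU.
  by case/eqP: xn0; rewrite -[x]ultra_class_repr; apply/ultra_class_eq0.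
apply: filterS => v /= /eqP xv.
by rewrite -[LHS]/((repr x v)^-1 * repr x v - 1) mulVf // subrr.
Qed.

Lemma ultra_inv0 : ultra_inv 0 = 0.
Proof.
apply/ultra_class_eq0; have /ultra_class_eq0 := ultra_class_repr 0.
by apply: filterS => v /= ->; rewrite invr0.
Qed.

HB.instance Definition _ :=
  GRing.ComNzRing_isField.Build ultrapower ultra_mulVf ultra_inv0.

Definition ultra_cst (c : K) : ultrapower := ultra_class (fun=> c).

Lemma ultra_cst_is_zmod_morphism : zmod_morphism ultra_cst.
Proof. by move=> c d; rewrite -[RHS]rmorphB. Qed.

Lemma ultra_cst_is_monoid_morphism : monoid_morphism ultra_cst.
Proof.
by split=> [|c d]; rewrite -?[RHS]rmorphM -?[RHS](rmorph1 ultra_class).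
Qed.

HB.instance Definition _ :=
  GRing.isZmodMorphism.Build K ultrapower ultra_cst ultra_cst_is_zmod_morphism.
HB.instance Definition _ :=
  GRing.isMonoidMorphism.Build K ultrapower ultra_cst
    ultra_cst_is_monoid_morphism.

Definition ultra_mx a b (F : T -> 'M[K]_(a, b)) : 'M[ultrapower]_(a, b) :=
  \matrix_(i, j) ultra_class (fun v => F v i j).

Lemma ultra_mxM a b c (F : T -> 'M[K]_(a, b)) (G : T -> 'M[K]_(b, c)) :
  ultra_mx F *m ultra_mx G = ultra_mx (fun v => F v *m G v).
Proof.
apply/matrixP => i j; rewrite !mxE.
have -> : (fun v => (F v *m G v) i j)
          = \sum_l ((fun v => F v i l) * (fun v => G v l j)).
  by apply/funext => v; rewrite mxE fct_sumE.
by rewrite rmorph_sum; apply: eq_bigr => l _; rewrite !mxE -rmorphM.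
Qed.

(** With [ultra_mxM] and [ultra_mx_cst], this carries matrix identities that hold on a set of [U] to
    the ultrapower, a simple case of Los's theorem. *)
Lemma ultra_mx_eq a b (F G : T -> 'M[K]_(a, b)) :
  U [set v | F v = G v] -> ultra_mx F = ultra_mx G.
Proof.
move=> FG; apply/matrixP => i j; rewrite !mxE; apply/eqP.
rewrite -subr_eq0 -rmorphB; apply/eqP/ultra_class_eq0.
apply: filterS FG => v /= FG.
by rewrite -[LHS]/(F v i j - G v i j) FG subrr.
Qed.

Lemma ultra_mx_cst a b (M : 'M[K]_(a, b)) :
  ultra_mx (fun=> M) = map_mx ultra_cst M.
Proof. by apply/matrixP => i j; rewrite !mxE. Qed.

Lemma ultra_mx_tr a b (F : T -> 'M[K]_(a, b)) :
  (ultra_mx F)^T = ultra_mx (fun v => (F v)^T).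
Proof.
apply/matrixP => i j; rewrite !mxE; congr ultra_class.
by apply/funext => v; rewrite mxE.
Qed.

End Ultrapower.

(** The sets where a member of [M] is nonzero, cut with [S], are nonempty and form a filter base
    because [M] is closed under products; extend it to an ultrafilter. *)
Lemma ultrafilter_nonvanishing (T : Type) (K : fieldType) (S : set T)
    (M : set (T -> K)) :
    M (fun=> 1) -> (forall a b, M a -> M b -> M (fun v => a v * b v)) ->
    (forall a, M a -> exists2 v, S v & a v != 0) ->
  exists U : set_system T, [/\ UltraFilter U, U S &
    forall a, M a -> U [set v | a v != 0]%classic].
Proof.
move=> M1 MM Mn0.
pose F := filter_from M (fun a => [set v | S v /\ a v != 0]%classic).
have FF : ProperFilter F.
  apply: filter_from_proper; last by move=> a /Mn0[v Sv av]; exists v.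
  apply: filter_from_filter; first by exists (fun=> 1).
  move=> a b Ma Mb; exists (fun v => a v * b v); first exact: MM.
  by move=> v /= [Sv]; rewrite mulf_eq0 negb_or => /andP[].
have [U [UU FU]] := ultraFilterLemma FF; exists U; split=> //.
  by apply: FU; exists (fun=> 1) => // v [].
by move=> a Ma; apply: FU; exists a => // v [].
Qed.

(** * Stabilizers in coordinates *)

(** Needed because each w_j must be a single bracket, not a sum of brackets. *)
Lemma free_span_subseq (K : fieldType) (V : vectType K) (s : seq V) :
  exists t : seq V, [/\ free t, {subset t <= s} & <<t>>%VS = <<s>>%VS].
Proof.
elim: s => [|v s [t [tfree ts spt]]]; first by exists [::]; rewrite nil_free.
have [vs|vs] := boolP (v \in <<s>>%VS).
  exists t; split=> // [x /ts xs|]; first by rewrite inE xs orbT.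
  rewrite span_cons spt; apply/esym/addv_idPr.
  by rewrite -memvE.
exists (v :: t); rewrite free_cons spt vs !span_cons spt; split=> // x.
by rewrite !inE => /predU1P[->|/ts->]; rewrite ?eqxx ?orbT.
Qed.

Lemma free_take (K : fieldType) (V : vectType K) (s : seq V) k :
  free s -> free (take k s).
Proof. by rewrite -{1}(cat_take_drop k s) => /catl_free. Qed.

Section LieCoordinates.
Variables (K : fieldType) (g : lieAlgType K).
Local Notation dual := 'Hom(g, K^o).
Local Notation n := (\dim {:dual}).
Local Notation r := (\dim {:g}).
Local Notation e := (vbasis {:dual}).
Local Notation b := (vbasis {:g}).
Implicit Types (x y : g) (mu : dual).

Lemma lieC x y : lie x y = - lie y x.
Proof.
apply/eqP; rewrite -addr_eq0; apply/eqP; have := liexx (x + y).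
have addl u v w : lie (u + v) w = lie u w + lie v w :> g.
  by have := lie_linearl w 1 u v; rewrite !scale1r.
have addr u v w : lie w (u + v) = lie w u + lie w v :> g.
  by have := lie_linearr w 1 u v; rewrite !scale1r.
by rewrite addl !addr !liexx add0r addr0.
Qed.

Lemma lie_suml (I : finType) (a : I -> K) (u : I -> g) x :
  lie (\sum_i a i *: u i) x = \sum_i a i *: lie (u i) x.
Proof.
pose f : {linear g -> g} := HB.pack (lie^~ x)
  (GRing.isLinear.Build K g g *:%R (lie^~ x) (lie_linearl x)).
by rewrite -[LHS]/(f _) linear_sum; apply: eq_bigr => i _; rewrite linearZ.
Qed.

Definition bracket_form mu : 'M[K]_r := \matrix_(p, q) mu (lie b`_p b`_q).
Definition coord_row x : 'rV[K]_r := \row_p coord b p x.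

Lemma bracket_form_sum mu :
  \sum_l coord e l mu *: bracket_form e`_l = bracket_form mu.
Proof.
apply/matrixP => p q; rewrite summxE mxE.
rewrite {2}(coord_vbasis (memvf mu)) sum_lfunE.
by apply: eq_bigr => l _; rewrite !mxE scale_lfunE.
Qed.

Lemma coord_row_bracket_form mu x q :
  (coord_row x *m bracket_form mu) 0 q = mu (lie x b`_q).
Proof.
rewrite mxE {2}(coord_vbasis (memvf x)) lie_suml linear_sum.
by apply: eq_bigr => p _; rewrite !mxE linearZ.
Qed.

Lemma bracket_formT mu : (bracket_form mu)^T = - bracket_form mu.
Proof. by apply/matrixP => p q; rewrite !mxE lieC linearN. Qed.

Lemma bracket_form_coord_row mu x y :
  (coord_row x *m bracket_form mu *m (coord_row y)^T) 0 0 = mu (lie x y).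
Proof.
rewrite lieC linearN {2}(coord_vbasis (memvf y)) lie_suml linear_sum -sumrN mxE.
apply: eq_bigr => q _; rewrite coord_row_bracket_form !mxE linearZ /=.
by rewrite lieC linearN mulrC -mulrN.
Qed.

Lemma stab_coord_row mu x :
  x \in stab mu -> coord_row x *m bracket_form mu = 0.
Proof.
move/stabP => xmu; apply/rowP => q.
by rewrite coord_row_bracket_form xmu mxE.
Qed.

Lemma dual_eq0 x : (forall l : 'I_n, (e`_l : dual) x = 0) -> x = 0.
Proof.
move=> ex0; rewrite (coord_vbasis (memvf x)) big1 // => p _.
pose f : dual := linfun (coord b p : g -> K^o).
have -> : coord b p x = f x by rewrite lfunE.
rewrite (coord_vbasis (memvf f)) sum_lfunE big1 ?scale0r // => l _.
by rewrite scale_lfunE ex0 scaler0.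
Qed.

(** Stabilizing [mu] and having independent brackets, the latter through a left inverse [M.2],
    become matrix identities, which pass to the ultrapower. *)
Lemma derived_stab_witness k mu :
    mu \in derived_stab_ge g k ->
  exists M : 'M[K]_(k, r) * 'M[K]_(k, r) * 'M[K]_(k, n),
  [/\ M.1.1 *m bracket_form mu = 0, bracket_form mu *m M.1.2^T = 0 &
      M.2 *m \matrix_(l, j) (M.1.1 *m bracket_form e`_l *m M.1.2^T) j j = 1%:M].
Proof.
rewrite inE /liev; set s := (X in <<X>>%VS) => le_k.
have [t [tfree ts spt]] := free_span_subseq s.
pose w := take k t.
have szw : size w == k.
  by rewrite size_takel // -(eqnP tfree) spt.
have wfree : free w by apply: free_take.
have wP (j : 'I_k) : exists xy : g * g,
    [/\ xy.1 \in stab mu, xy.2 \in stab mu & w`_j = lie xy.1 xy.2].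
  have : w`_j \in s by apply/ts/(mem_take (n0 := k))/mem_nth; rewrite (eqP szw).
  by case/allpairsP=> -[x y] [/vbasis_mem xs /vbasis_mem ys ->]; exists (x, y).
have [xy xyP] := choice wP.
pose X := \matrix_j coord_row (xy j).1; pose Y := \matrix_j coord_row (xy j).2.
pose W := \matrix_(l < n, j < k) (e`_l : dual) (w`_j).
(* The columns of [W] inherit independence from [w], since the basis of the dual separates
   points. *)
have /row_freeP[N WN] : row_free W^T.
  apply: inj_row_free => c cW; apply/rowP => j; rewrite mxE.
  have /freeP w_indep : free (Tuple szw) := wfree; apply: (w_indep (c 0)).
  apply: dual_eq0 => l; rewrite linear_sum; have /rowP/(_ l) := cW.
  rewrite !mxE => cl; rewrite -[RHS]cl; apply: eq_bigr => i _.
  by rewrite !mxE linearZ.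
exists (X, Y, N^T); split=> /=.
- apply/row_matrixP => j; rewrite row_mul rowK row0.
  by apply: stab_coord_row; have [] := xyP j.
- apply: trmx_inj; rewrite trmx_mul trmxK trmx0 bracket_formT mulmxN.
  apply/eqP; rewrite oppr_eq0; apply/eqP/row_matrixP => j.
  rewrite row_mul rowK row0.
  by apply: stab_coord_row; have [] := xyP j.
- apply: trmx_inj; rewrite trmx_mul trmxK trmx1 -WN; congr (_^T *m _).
  apply/matrixP => l j; rewrite !mxE; have [_ _ ->] := xyP j.
  rewrite -bracket_form_coord_row [RHS]mxE; apply: eq_bigr => p _.
  by rewrite !mxE; congr (_ * _); apply: eq_bigr => q _; rewrite !mxE.
Qed.

End LieCoordinates.

(** * The generic point and the codimension bound *)

Section Evaluation.
Variables (K : fieldType) (V : vectType K).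

Lemma polyfunD (f h : {mpoly K[\dim {:V}]}) v :
  polyfun (f + h) v = polyfun f v + polyfun h v.
Proof. exact: rmorphD. Qed.

Lemma polyfunM (f h : {mpoly K[\dim {:V}]}) v :
  polyfun (f * h) v = polyfun f v * polyfun h v.
Proof. exact: rmorphM. Qed.

(** Hence [f] vanishes at the point of coordinate classes exactly when it vanishes on a set of
    [U]. *)
Lemma ev_ultrapower (T : pointedType) (U : set_system T) (UU : UltraFilter U)
    (pt : T -> V) f :
  ev (ultra_cst UU)
     (fun l => ultra_class UU (fun v => coord (vbasis {:V}) l (pt v))) f
  = ultra_class UU (fun v => polyfun f (pt v)).
Proof.
elim/mpoly_ring_ind: f => [c|l|f h IHf IHh|f h IHf IHh].
- rewrite /ev mmapC; congr ultra_class; apply/funext => v.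
  by rewrite /polyfun mevalC.
- rewrite /ev mmapX mmap1U; congr ultra_class; apply/funext => v.
  by rewrite /polyfun mevalXU.
- rewrite [LHS]rmorphD /= IHf IHh -rmorphD; congr ultra_class.
  by apply/funext => v; rewrite polyfunD.
- rewrite [LHS]rmorphM /= IHf IHh -rmorphM; congr ultra_class.
  by apply/funext => v; rewrite polyfunM.
Qed.

End Evaluation.

Lemma derived_stab_codim (K : fieldType) (g : lieAlgType K) (k : nat) :
  [pchar K] =i pred0 -> codim_ge (derived_stab_ge g k) k.
Proof.
move=> charK d P [vanP chainP].
pose V := 'Hom(g, K^o); pose S := derived_stab_ge g k.
pose A := {mpoly K[\dim {:V}]}.
have KT_closed : subring_closed (xpredT : {pred K}) by split.
pose KT : subringClosed K :=
  HB.pack (xpredT : K -> bool) (GRing.isSubringClosed.Build K xpredT KT_closed).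
pose E : subringClosed A := gens (subring_image (@mpolyC _ K) KT) [::].
have constE c : c%:MP \in E by apply/subring_imageP; exists c.
have [||fs [szfs indfs fs0]] := @chain_algindep A E d P.
(* A nonzero constant is invertible, so no proper ideal contains it. *)
- move=> I z /subring_imageP[c _ ->] cI; have [->|c0] := eqVneq c 0.
    exact: mpolyC0.
  have := idealMr c^-1%:MP cI.
  by rewrite -[X in X \in _]mpolyCM mulVf // mpolyC1 idealr1.
- exact: chainP.
pose T : pointedType := HB.pack V (isPointed.Build V 0).
(* The nonzero elements of K[f_1, ..., f_d], as functions on the dual. *)
pose nonzero : set (T -> K) :=
  fun a => exists f : A, [/\ f \in gens E fs, f != 0 & a = polyfun f].
have [||| U [UU US Un0]] :=
  @ultrafilter_nonvanishing T K [set mu | mu \in S]%classic nonzero.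
- exists 1; rewrite rpred1 oner_eq0; split=> //; apply/funext => v.
  by rewrite /polyfun meval1.
- move=> _ _ [f [fE f0 ->]] [h [hE h0 ->]].
  exists (f * h); rewrite rpredM // mulf_neq0 //; split=> //; apply/funext => v.
  by rewrite polyfunM.
(* A polynomial vanishing on [S] lies in [P ord0], which meets [gens E fs] only in 0. *)
- move=> _ [f [fE f0 ->]]; apply: contrapT => vanf.
  case/eqP: f0; apply: fs0 => //; apply: vanP => mu muS; apply/eqP.
  by apply: contrapT => /negP fmu; apply: vanf; exists mu.
pose pt (mu : T) : V := mu.
pose iota : {rmorphism K -> ultrapower K UU} := ultra_cst UU.
pose m l := ultra_class UU (fun mu => coord (vbasis {:V}) l (pt mu)).
have m_inj f : f \in gens E fs -> ev iota m f = 0 -> f = 0.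
  move=> fE; rewrite ev_ultrapower => /ultra_class_eq0 f0.
  apply: contrapT => /eqP fn0.
  have fU : U [set mu | polyfun f (pt mu) != 0]%classic by apply: Un0; exists f.
  by have [mu /= [-> /eqP]] := filter_ex (filterI f0 fU).
(* Off [S] the witness defaults to 0, which is harmless since [S] is in [U]. *)
have /choice[M MP] (mu : T) : exists M : 'M[K]_(k, \dim {:g}) *
    'M[K]_(k, \dim {:g}) * 'M[K]_(k, \dim {:V}), pt mu \in S ->
  [/\ M.1.1 *m bracket_form mu = 0, bracket_form mu *m M.1.2^T = 0 &
      M.2 *m \matrix_(l, j)
        (M.1.1 *m bracket_form (vbasis {:V})`_l *m M.1.2^T) j j = 1%:M].
  have [/derived_stab_witness[M ?]|_] := boolP (pt mu \in S); first by exists M.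
  by exists 0.
pose X := ultra_mx UU (fun mu => (M mu).1.1).
pose Y := ultra_mx UU (fun mu => (M mu).1.2).
pose N := ultra_mx UU (fun mu => (M mu).2).
pose gam (l : 'I_(\dim {:V})) := bracket_form ((vbasis {:V})`_l : V).
have formE : generic_form iota m gam
             = ultra_mx UU (fun mu => bracket_form (pt mu)).
  apply/matrixP => p q; rewrite summxE mxE.
  under eq_bigr => l _ do rewrite !mxE -[iota _]/(ultra_class _ _) -rmorphM.
  rewrite -rmorph_sum; congr ultra_class; apply/funext => mu.
  rewrite fct_sumE -bracket_form_sum summxE; apply: eq_bigr => l _.
  by rewrite !mxE.
have bracketE : bracket_mx iota gam X Y
    = ultra_mx UU (fun mu =>
        \matrix_(l, j) ((M mu).1.1 *m gam l *m (M mu).1.2^T) j j).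
  apply/matrixP => l j; rewrite mxE -ultra_mx_cst ultra_mx_tr !ultra_mxM !mxE.
  by congr ultra_class; apply/funext => mu; rewrite [RHS]mxE.
(* Beside the characteristic, what remains are matrix identities valid at every point of [S], hence
   in the ultrapower. *)
rewrite -szfs; apply: (@generic_codim_ge _ K _ iota _ m E constE fs indfs m_inj
          k _ gam X Y _ _ N).
- by move=> p; rewrite (fmorph_pchar iota).
- rewrite formE ultra_mxM (ultra_mx_eq UU (G := fun=> 0)).
    by rewrite ultra_mx_cst map_mx0.
  by apply: filterS US => mu /MP[].
- rewrite formE ultra_mx_tr ultra_mxM (ultra_mx_eq UU (G := fun=> 0)).
    by rewrite ultra_mx_cst map_mx0.
  by apply: filterS US => mu /MP[].
- rewrite bracketE ultra_mxM (ultra_mx_eq UU (G := fun=> 1%:M)).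
    by rewrite ultra_mx_cst map_mx1.
  by apply: filterS US => mu /MP[].
Qed.

Theorem corollary2p2 (R : realType) (k : nat) :
  (forall g : lieAlgType R, codim_ge (derived_stab_ge g k) k) /\
  (forall g : lieAlgType R[i], codim_ge (derived_stab_ge g k) k).
Proof.
by split=> g; apply: derived_stab_codim; apply: Num.Theory.pchar_num.
Qed.
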